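(* Let $n\ge 2$ and let $T,T'$ be triangulations of $C(n+2,3)$. Then $T'$ is obtained from $T$ by a bistellar up-flip if and only if $E(\Gamma(T)) = E(\Gamma(T'))\cup\{e\}$ for some edge $e\in E(\Gamma(T))\setminus E(\Gamma(T'))$. In particular, $T\le_1 T'$ if and only if $E(\Gamma(T))\supseteq E(\Gamma(T'))$.
   Context: The cyclic polytope $C(n+2,3)$ is the convex hull of $n+2$ points on the moment curve $t\mapsto(t,t^2,t^3)$, with vertices labelled $0,\dots,n+1$ in increasing order of the parameter; simplices are identified with their vertex sets. A triangulation is a set $T$ of 3-simplices (4-element vertex subsets) whose convex hulls cover the polytope and pairwise intersect in a common (possibly empty) face; $F_1(T)$ is the set of 2-element sets contained in some simplex of $T$, and $\Gamma(T)$ is the graph $([n],F_1(T)\cap\binom{[n]}{2})$. For five vertices $v_1<v_2<v_3<v_4<v_5$ let $T_*=\{\{v_1,v_2,v_4,v_5\},\{v_1,v_2,v_3,v_4\},\{v_2,v_3,v_4,v_5\}\}$ and $T^*=\{\{v_1,v_2,v_3,v_5\},\{v_1,v_3,v_4,v_5\}\}$. If $T$ is a triangulation with $T_*\subseteq T$, then $T'=(T\setminus T_* )\cup T^*$ is a triangulation, and $T'$ is said to be obtained from $T$ by a bistellar up-flip. The first Stasheff-Tamari order is defined by $T\le_1 T'$ iff $T'$ is obtained from $T$ by a (possibly empty) finite sequence of bistellar up-flips. *)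

(* Defs.v *)
From HB Require Import structures.
From mathcomp Require Import all_boot all_order all_algebra.
Set Implicit Arguments. Unset Strict Implicit. Unset Printing Implicit Defensive.
Import Order.TTheory GRing.Theory Num.Theory.
Local Open Scope ring_scope.

Section Cyclic.
Variable R : realFieldType.
Variable n : nat.
(* vertices 0, ..., n+1 of C(n+2,3); parameter values t on the moment curve *)
Variable t : 'I_n.+2 -> R.

Definition vertex_pt (i : 'I_n.+2) : 'rV[R]_3 := \row_(j < 3) (t i) ^+ j.+1.

Definition conv (S : {set 'I_n.+2}) (x : 'rV[R]_3) : Prop :=
  exists lam : 'I_n.+2 -> R,
    [/\ forall i, 0 <= lam i,
        forall i, i \notin S -> lam i = 0,
        \sum_i lam i = 1
      & x = \sum_i lam i *: vertex_pt i].

Definition cyclic_polytope (x : 'rV[R]_3) : Prop := conv [set: 'I_n.+2] x.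

(* a face of the simplex with vertex set S: convex hull of a subset of S *)
Definition common_face (S U : {set 'I_n.+2}) : Prop :=
  exists A B : {set 'I_n.+2},
    [/\ A \subset S, B \subset U,
        (forall x, (conv S x /\ conv U x) <-> conv A x)
      & (forall x, (conv S x /\ conv U x) <-> conv B x)].

Definition triangulation (T : {set {set 'I_n.+2}}) : Prop :=
  [/\ forall S, S \in T -> #|S| = 4,
      forall x, cyclic_polytope x -> exists2 S, S \in T & conv S x,
      forall S, S \in T -> forall x, conv S x -> cyclic_polytope x
    & forall S U, S \in T -> U \in T -> common_face S U].

End Cyclic.

Section Flips.
Variable n : nat.

Definition Tlow (v1 v2 v3 v4 v5 : 'I_n.+2) : {set {set 'I_n.+2}} :=
  [set [set v1; v2; v4; v5]; [set v1; v2; v3; v4]; [set v2; v3; v4; v5]].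
Definition Tup (v1 v2 v3 v4 v5 : 'I_n.+2) : {set {set 'I_n.+2}} :=
  [set [set v1; v2; v3; v5]; [set v1; v3; v4; v5]].

Definition upflip (T T' : {set {set 'I_n.+2}}) : Prop :=
  exists v1 v2 v3 v4 v5 : 'I_n.+2,
    [/\ [&& (v1 < v2)%N, (v2 < v3)%N, (v3 < v4)%N & (v4 < v5)%N],
        Tlow v1 v2 v3 v4 v5 \subset T
      & T' = (T :\: Tlow v1 v2 v3 v4 v5) :|: Tup v1 v2 v3 v4 v5].

Inductive le1 : {set {set 'I_n.+2}} -> {set {set 'I_n.+2}} -> Prop :=
| le1_refl T : le1 T T
| le1_step T T' T'' : upflip T T' -> le1 T' T'' -> le1 T T''.

Definition F1 (T : {set {set 'I_n.+2}}) : {set {set 'I_n.+2}} :=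
  [set e : {set 'I_n.+2} | (#|e| == 2) && [exists S in T, e \subset S]].

Definition inner_vertices : {set 'I_n.+2} :=
  [set i : 'I_n.+2 | (1 <= i)%N && (i <= n)%N].

Definition Gamma_edges (T : {set {set 'I_n.+2}}) : {set {set 'I_n.+2}} :=
  [set e in F1 T | e \subset inner_vertices].

End Flips.

(* Main.v *)
(* Only two facts about the geometry matter.  First, an affine dependency on the
   moment curve changes sign at least four times, so two simplices fail to meet in
   a common face exactly when a triangle a < c < e of one is crossed by an edge
   b < d of the other with a < b < c < d < e.  Secondly, since the barycentre of
   any set of vertices is covered, every set crossing no simplex of T lies in a
   simplex of T.  Hence T is determined by its edges, and a non-edge b d always
   crosses a triangle of T.

   Now let the edges F' of T' form a proper subset of the edges F of T.  Call an
   edge b d of F laminar when no p < q strictly between b and d satisfy b q, p d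
   in F.  A shortest edge of F \ F' is laminar; take a longest laminar one, b d.
   Laminarity gives a unique c between b and d joined to both.  Let e be the least
   vertex after d joined to b, and a the greatest vertex before b joined to d.
   Maximality forces the link of b d in T to be the triangle a c e, for otherwise
   b e or a d would be a longer laminar edge of F \ F'.  So T admits an up-flip
   removing b d, and one concludes by induction on the number of edges. *)
Require Import Defs.
From HB Require Import structures.
From mathcomp Require Import all_boot all_order all_algebra.
From mathcomp Require Import zify ring lra.
Import Order.TTheory GRing.Theory Num.Theory.
Set Implicit Arguments. Unset Strict Implicit. Unset Printing Implicit Defensive.
Local Open Scope ring_scope.

(* Hypotheses outside linear arithmetic make [lia] very slow. *)
Ltac ord_lia :=
  repeat match goal with H : ?P |- _ =>
    lazymatch P with
    | @eq nat _ _ => fail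
    | is_true (leq _ _) => fail
    | is_true (_ && _) => fail
    | is_true (_ || _) => fail
    | _ => clear H
    end
  end; lia.

(** * Persistent graphs *)

Section Persistent.
Local Open Scope nat_scope.
Variable m : nat.
Implicit Types (F : rel 'I_m) (a b c d e p q u v x y z w : 'I_m).

Definition uncrossed F a c e :=
  forall x y, a < x < c -> c < y < e -> ~ F x y.

(* The edges of a triangulation form such a graph: a missing edge must cross one of
   its triangles, and no edge crosses that triangle. *)
Definition persistent F := forall b d, b < d -> ~~ F b d ->
  exists a c e, [/\ a < b < c, c < d < e,
    [/\ F a c, F c e & F a e] & uncrossed F a c e].

(** A non-edge [x w] would cross an uncrossed triangle with middle vertex [c]. As [x z] does not
    cross it, [c] is not before [z]; then [y w] crosses it. *)
Lemma persistent_cross F x y z w : persistent F ->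
  x < y -> y < z -> z < w -> F x z -> F y w -> F x w.
Proof.
move=> pF xy yz zw Fxz Fyw; apply/negPn/negP => nFxw.
have [|a [c [e [xc cw _ unc]]]] := pF x w _ nFxw; first by ord_lia.
have zc : z <= c by rewrite leqNgt; apply/negP => cz; apply: (unc x z) => //; ord_lia.
by apply: (unc y w) => //; ord_lia.
Qed.


Lemma persistent_succ F x y : persistent F -> y = x.+1 :> nat -> F x y.
Proof.
move=> pF yx; apply/negPn/negP => nF.
by have [|a [c [e [xc cy _ _]]]] := pF x y _ nF; ord_lia.
Qed.

Lemma ord_trichotomy x y : [\/ x < y, x = y | y < x].
Proof.
by case: (ltngtP x y) => [||/val_inj] ?; [apply: Or31 | apply: Or33 | apply: Or32].
Qed.

(** Persistence survives reversal of the vertex order, so facts about the right end of an edge yield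
    their mirror images. *)
Definition rev_rel F : rel 'I_m := fun x y => F (rev_ord y) (rev_ord x).

Lemma rev_persistent F : persistent F -> persistent (rev_rel F).
Proof.
move=> pF b d bd nF; have ltb := ltn_ord b; have ltd := ltn_ord d.
have [|a [c [e [ab ce [Fac Fce Fae] unc]]]] := pF _ _ _ nF; first by rewrite /=; ord_lia.
have lta := ltn_ord a; have ltc := ltn_ord c; have lte := ltn_ord e.
rewrite /= in ab ce.
exists (rev_ord e), (rev_ord c), (rev_ord a); split=> /=; try ord_lia.
  by rewrite /rev_rel !rev_ordK.
move=> x y /= xP yP; have ltx := ltn_ord x; have lty := ltn_ord y.
by apply: unc => /=; ord_lia.
Qed.

(** If [d e] or [c e] were missing, an uncrossed triangle [x y z] would exist, with [x] not before
    [b] because of [b e]. It yields, directly or by [persistent_cross], an edge excluded by the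
    choice of [c] or [e]; the edge [p e] serves against triangles starting at [b]. *)
Lemma flip_right_edges F b c d e p : persistent F ->
    (forall x, b < x < d -> F x d -> c <= x) ->
    (forall x, b < x < d -> F b x -> x <= c) ->
    (forall v, d < v < e -> ~ F b v) ->
    b < c < d -> d < e -> b < p < d ->
    F b d -> F c d -> F b e -> F p e ->
  F d e /\ F c e.
Proof.
move=> pF minc maxc mine bcd de bpd Fbd Fcd Fbe Fpe.
split; apply/negPn/negP => nF.
  have [//|x [y [z [xP yP [Fxy Fyz Fxz] unc]]]] := pF _ _ _ nF.
  have bx : b <= x by rewrite leqNgt; apply/negP => xb; apply: (unc b e) => //; ord_lia.
  have px : p <= x by rewrite leqNgt; apply/negP => xp; apply: (unc p e) => //; ord_lia.
  apply: (mine y); first ord_lia.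
  by apply: (persistent_cross (y := x) (z := d)) => //; ord_lia.
have [|x [y [z [xP yP [Fxy Fyz Fxz] unc]]]] := pF _ _ _ nF; first ord_lia.
have bx : b <= x by rewrite leqNgt; apply/negP => xb; apply: (unc b e) => //; ord_lia.
have [yd|yd|dy] := ord_trichotomy y d.
- have [bx'|exb|] := ord_trichotomy b x; last ord_lia.
    suff: c <= x by ord_lia.
    apply: minc; first ord_lia.
    by apply: (persistent_cross (y := c) (z := y)) => //; ord_lia.
  subst x; suff: y <= c by ord_lia.
  by apply: maxc => //; ord_lia.
- subst y; have [bx'|exb|] := ord_trichotomy b x; last ord_lia.
    suff: c <= x by ord_lia.
    by apply: minc => //; ord_lia.
  by subst x; apply: (unc p e) => //; ord_lia.
have [bx'|exb|] := ord_trichotomy b x; last ord_lia.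
  apply: (mine y); first ord_lia.
  by apply: (persistent_cross (y := x) (z := d)) => //; ord_lia.
by subst x; apply: (mine y) => //; ord_lia.
Qed.

Lemma flip_left_edges F a b c d q : persistent F ->
    (forall x, b < x < d -> F x d -> c <= x) ->
    (forall x, b < x < d -> F b x -> x <= c) ->
    (forall u, a < u < b -> ~ F u d) ->
    b < c < d -> a < b -> b < q < d ->
    F b d -> F b c -> F a d -> F a q ->
  F a b /\ F a c.
Proof.
move=> pF minc maxc maxa bcd ab bqd Fbd Fbc Fad Faq.
have lta := ltn_ord a; have ltb := ltn_ord b; have ltc := ltn_ord c.
have ltd := ltn_ord d; have ltq := ltn_ord q.
have := @flip_right_edges (rev_rel F) (rev_ord d) (rev_ord c) (rev_ord b)
  (rev_ord a) (rev_ord q) (rev_persistent pF).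
rewrite /rev_rel !rev_ordK; apply=> //=; try ord_lia.
- move=> x xP Fbx; have ltx := ltn_ord x.
  by have := maxc _ _ Fbx; rewrite /=; ord_lia.
- move=> x xP Fxd; have ltx := ltn_ord x.
  by have := minc _ _ Fxd; rewrite /=; ord_lia.
- move=> x xP; have ltx := ltn_ord x.
  by apply: maxa; rewrite /=; ord_lia.
Qed.

(** The three lower simplices have nine triangles: all triples but [a c e], which [b d] crosses. The
    first four listed are those of [a b d e]. *)
Definition flippable F a b c d e :=
  [/\ [&& a < b, b < c, c < d & d < e],
      [/\ F a b, F a c, F a d & F a e],
      [/\ F b c, F b d & F b e], [/\ F c d, F c e & F d e]
    & [/\ uncrossed F a b d, uncrossed F a b e, uncrossed F a d e & uncrossed F b d e]
   /\ [/\ uncrossed F a b c, uncrossed F a c d, uncrossed F b c d,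
          uncrossed F b c e & uncrossed F c d e]].

Definition laminar F b d :=
  [forall p : 'I_m, forall q : 'I_m, [&& b < p, p < q, q < d & F b q] ==> ~~ F p d].

Lemma laminarP F b d :
  reflect (forall p q, b < p -> p < q -> q < d -> F b q -> ~ F p d) (laminar F b d).
Proof.
apply: (iffP forallP) => [lam p q bp pq qd Fbq | lam p].
  by have /forallP/(_ q) := lam p; rewrite bp pq qd Fbq => /negP.
apply/forallP => q; apply/implyP => /and4P[bp pq qd Fbq].
by apply/negP; apply: (lam p q).
Qed.

(** Edges that might cross a triangle are sorted by the position of their ends relative to [b], [c]
    and [d]. Each case leads to an edge excluded by the choice of [a], [c] or [e]. *)
Lemma flippableP F a b c d e p q : persistent F ->
    (forall x, b < x < d -> F x d -> c <= x) ->
    (forall x, b < x < d -> F b x -> x <= c) ->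
    (forall v, d < v < e -> ~ F b v) ->
    (forall u, a < u < b -> ~ F u d) ->
    a < b -> b < c < d -> d < e -> b < p < d -> b < q < d ->
    F b d -> F b c -> F c d -> F a d -> F b e -> F p e -> F a q ->
  flippable F a b c d e.
Proof.
move=> pF minc maxc mine maxa ab bcd de bpd bqd Fbd Fbc Fcd Fad Fbe Fpe Faq.
have [Fde Fce] := flip_right_edges pF minc maxc mine bcd de bpd Fbd Fcd Fbe Fpe.
have [Fab Fac] := flip_left_edges pF minc maxc maxa bcd ab bqd Fbd Fbc Fad Faq.
have Fae : F a e by apply: (persistent_cross (y := b) (z := d)) => //; ord_lia.
have right_unc u v : b <= u < d -> d < v < e -> ~ F u v.
  move=> uP vP Fuv; apply: (mine v vP).
  have [bu|->//|] := ord_trichotomy b u; last ord_lia.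
  by apply: (persistent_cross (y := u) (z := d)) => //; ord_lia.
have left_unc u v : a < u < b -> b < v <= d -> ~ F u v.
  move=> uP vP Fuv; apply: (maxa u uP).
  have [vd|<-//|] := ord_trichotomy v d; last ord_lia.
  by apply: (persistent_cross (y := b) (z := v)) => //; ord_lia.
have mid_unc u v : b <= u < c -> c < v <= d -> (b < u) || (v < d) -> ~ F u v.
  move=> uP vP uv Fuv.
  have [vd|evd|] := ord_trichotomy v d; last ord_lia.
    suff: v <= c by ord_lia.
    apply: maxc; first ord_lia.
    have [bu|->//|] := ord_trichotomy b u; last ord_lia.
    by apply: (persistent_cross (y := u) (z := c)) => //; ord_lia.
  subst v; suff: c <= u by ord_lia.
  by apply: minc => //; ord_lia.
(* Descent on [v]. The non-edge [b v] gives an uncrossed triangle [x y z]; since [u v] and [b d] do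
   not cross it, [x] is not before [u] and [y] not before [d]. If [y = d], the choice of [a] is
   violated; otherwise [x y] is an instance with [y < v]. *)
have far_unc u v : a < u < b -> d < v < e -> ~ F u v.
  have [k] := ubnP v; elim: k u v => // k IHk u v vk uP vP Fuv.
  have nFbv : ~~ F b v by apply/negP; apply: mine.
  have [|x [y [z [xP yP [Fxy Fyz Fxz] unc]]]] := pF _ _ _ nFbv; first ord_lia.
  have ux : u <= x by rewrite leqNgt; apply/negP => xu; apply: (unc u v) => //; ord_lia.
  have dy : d <= y by rewrite leqNgt; apply/negP => yd; apply: (unc b d) => //; ord_lia.
  have [|eyd|d_y] := ord_trichotomy y d; first ord_lia.
    by apply: (maxa x); [ord_lia | rewrite -eyd].
  by apply: (IHk x y) => //; ord_lia.
split=> //; first ord_lia.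
split; split=> u v uP vP.
- by apply: left_unc; ord_lia.
- by case: (leqP v d) => vd; [apply: left_unc | apply: far_unc]; ord_lia.
- by case: (ltnP u b) => ub; [apply: far_unc | apply: right_unc]; ord_lia.
- by apply: right_unc; ord_lia.
- by apply: left_unc; ord_lia.
- by case: (ltnP u b) => ub; [apply: left_unc | apply: mid_unc]; ord_lia.
- by apply: mid_unc; ord_lia.
- by case: (leqP v d) => vd; [apply: mid_unc | apply: right_unc]; ord_lia.
- by apply: right_unc; ord_lia.
Qed.

Lemma nlaminarP F b d : ~~ laminar F b d ->
  exists p q, [/\ b < p, p < q, q < d, F b q & F p d].
Proof.
rewrite negb_forall => /existsP[p]; rewrite negb_forall => /existsP[q].
by rewrite negb_imply negbK => /andP[/and4P[? ? ? ?] ?]; exists p, q.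
Qed.

(** Let [c] be the first neighbour of [d] after [b]; one exists since [d - 1] is joined to [d].
    Laminarity bounds the neighbours of [b] by [c]. Were [b c] missing, the middle vertex of the
    triangle it crosses would be an earlier neighbour of [d]. *)
Lemma laminar_apex F b d : persistent F -> b.+1 < d -> F b d -> laminar F b d ->
  exists c, [/\ b < c < d, F b c, F c d,
    forall x, b < x < d -> F x d -> c <= x & forall x, b < x < d -> F b x -> x <= c].
Proof.
move=> pF bd Fbd /laminarP lam; have ltd := ltn_ord d.
have d'm : d.-1 < m by ord_lia.
have Pd : (b < Ordinal d'm < d) && F (Ordinal d'm) d.
  by rewrite (persistent_succ pF) /=; ord_lia.
case: (@arg_minnP _ _ (fun x => (b < x < d) && F x d) (@nat_of_ord m) Pd).
move=> c /andP[bcd Fcd] minc0.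
have minc x : b < x < d -> F x d -> c <= x.
  by move=> xP Fxd; apply: minc0; rewrite xP.
exists c; split=> //; last first.
  move=> x xP Fbx; rewrite leqNgt; apply/negP => cx.
  by apply: (lam c x) => //; ord_lia.
apply/negPn/negP => nF.
have [|x [y [z [xP yP [Fxy Fyz Fxz] unc]]]] := pF _ _ _ nF; first ord_lia.
have zd : z <= d by rewrite leqNgt; apply/negP => dz; apply: (unc b d) => //; ord_lia.
suff: c <= y by ord_lia.
apply: minc; first ord_lia.
have [zd'|<-//|] := ord_trichotomy z d; last ord_lia.
by apply: (persistent_cross (y := c) (z := z)) => //; ord_lia.
Qed.

(** * Existence of a flippable edge *)

Section FlippableEdge.
Variables F F' : rel 'I_m.
Hypotheses (pF : persistent F) (pF' : persistent F').
Hypothesis subF : forall x y, x < y -> F' x y -> F x y.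

Let D (s : 'I_m * 'I_m) := [&& s.1 < s.2, F s.1 s.2 & ~~ F' s.1 s.2].
Let len (s : 'I_m * 'I_m) := s.2 - s.1.

(** Two edges [b q] and [p d] spoiling laminarity of a shortest edge [b d] are shorter, hence in
    [F'], and [persistent_cross] would put [b d] in [F']. *)
Lemma exists_laminar b d : D (b, d) -> exists s, D s && laminar F s.1 s.2.
Proof.
move=> Dbd; case: (@arg_minnP _ (b, d) D len Dbd) => -[{Dbd} b' d'].
case/and3P=> /= bd Fbd nF'bd minD; exists (b', d').
rewrite /D /= bd Fbd nF'bd /=; apply/laminarP => p q bp pq qd Fbq Fpd.
have /negP[] := nF'bd; apply: (persistent_cross (y := p) (z := q)) => //.
  apply/negPn/negP => nF'; have := minD (b', q).
  by rewrite /D /len /= Fbq nF' andbT => /(_ _); ord_lia.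
apply/negPn/negP => nF'; have := minD (p, d').
by rewrite /D /len /= Fpd nF' andbT => /(_ _); ord_lia.
Qed.

Lemma exists_flippable b0 d0 : D (b0, d0) ->
  exists a b c d e, flippable F a b c d e /\ ~~ F' b d.
Proof.
case/exists_laminar=> s0 Ds0.
case: (@arg_maxnP _ s0 (fun s => D s && laminar F s.1 s.2) len Ds0) => -[b d].
case/andP=> /and3P[/= bd Fbd nF'bd] /laminarP lam maxD.
have [a' [c' [e' [abc cde [F'ac F'ce F'ae] unc']]]] := pF' bd nF'bd.
have Fac' : F a' c' by apply: subF => //; ord_lia.
have Fce' : F c' e' by apply: subF => //; ord_lia.
(* These two edges make the choices of [e] and [a] below range over nonempty sets. *)
have Fbe' : F b e' by apply: (persistent_cross (y := c') (z := d)) => //; ord_lia.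
have Fad' : F a' d by apply: (persistent_cross (y := b) (z := c')) => //; ord_lia.
have [|c [bcd Fbc Fcd minc maxc]] := laminar_apex pF _ Fbd (introT (laminarP _ _ _) lam).
  by ord_lia.
have Pe : (d < e') && F b e' by rewrite Fbe'; ord_lia.
have Pa : (a' < b) && F a' d by rewrite Fad'; ord_lia.
case: (@arg_minnP _ e' (fun v => (d < v) && F b v) (@nat_of_ord m) Pe) => e /andP[de Fbe] mine.
case: (@arg_maxnP _ a' (fun u => (u < b) && F u d) (@nat_of_ord m) Pa) => a /andP[ab Fad] maxa.
have ee' : e <= e' := mine _ Pe; have aa' : a' <= a := maxa _ Pa.
have {}mine v : d < v < e -> ~ F b v.
  by case/andP=> dv ve Fbv; have := mine v; rewrite dv Fbv => /(_ isT) /=; ord_lia.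
have {}maxa u : a < u < b -> ~ F u d.
  by case/andP=> au ub Fud; have := maxa u; rewrite ub Fud => /(_ isT) /=; ord_lia.
(* If [e] differs from [e'], then [b e] crosses the triangle [a' c' e'] and so is not in [F']. Being
   longer than [b d], it is not laminar, and a witness of this supplies [p]. *)
have [p [bpd Fpe]] : exists p, b < p < d /\ F p e.
  have [e_e'|->|] := ord_trichotomy e e'; [|by exists c'; split=> //; ord_lia|ord_lia].
  have nF'be : ~~ F' b e by apply/negP; apply: unc'; ord_lia.
  have [|p [q [bp pq qe Fbq Fpe]]] := @nlaminarP F b e.
    apply/negP => lam_be; have := maxD (b, e).
    by rewrite /D /len /= Fbe nF'be lam_be !andbT => /(_ _); ord_lia.
  exists p; split=> //; suff: ~ d < q by ord_lia.
  by move=> dq; apply: (mine q) => //; ord_lia.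
have [q [bqd Faq]] : exists q, b < q < d /\ F a q.
  have [a_a'|<-|] := ord_trichotomy a' a; [|by exists c'; split=> //; ord_lia|ord_lia].
  have nF'ad : ~~ F' a d by apply/negP; apply: unc'; ord_lia.
  have [|r [q [ar rq qd Faq Frd]]] := @nlaminarP F a d.
    apply/negP => lam_ad; have := maxD (a, d).
    by rewrite /D /len /= Fad nF'ad lam_ad !andbT => /(_ _); ord_lia.
  exists q; split=> //; suff: ~ r < b by ord_lia.
  by move=> rb; apply: (maxa r) => //; ord_lia.
by exists a, b, c, d, e; split=> //; apply: (flippableP (p := p) (q := q)).
Qed.

End FlippableEdge.

End Persistent.

(** * Affine dependencies on the moment curve *)

Section Geometry.
Variables (R : realFieldType) (n : nat) (t : 'I_n.+2 -> R).
Hypothesis ht : forall i j : 'I_n.+2, (i < j)%N -> t i < t j.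
Local Notation V := 'I_n.+2.
Implicit Types (i j a b c d e : V) (w lam mu : V -> R) (S U : {set V}).

Lemma le_param i j : (i <= j)%N -> t i <= t j.
Proof. by rewrite leq_eqVlt => /orP[/eqP/val_inj-> // | /ht/ltW]. Qed.

(** The exponent 0 gives total weight zero, the exponents 1 to 3 the coordinates. Equivalently, [w]
    annihilates all polynomials of degree at most 3 in the parameter. *)
Definition affine_dep w := forall k, (k < 4)%N -> \sum_i w i * t i ^+ k = 0.

Lemma affine_dep_prod w (s : seq V) k : affine_dep w -> (k + size s < 4)%N ->
  \sum_i w i * (t i ^+ k * \prod_(j <- s) (t j - t i)) = 0.
Proof.
move=> dep; elim: s k => [|j s IHs] k /= ks.
  rewrite -[RHS](dep k); last by rewrite addn0 in ks.
  by apply: eq_bigr => i _; rewrite big_nil mulr1.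
have [E0 E1] : _ /\ _ := conj (IHs k ltac:(lia)) (IHs k.+1 ltac:(lia)).
transitivity (t j * 0 - 0 : R); last by rewrite mulr0 subr0.
rewrite -[X in t j * X]E0 -[X in _ - X]E1 mulr_sumr -sumrB.
apply: eq_bigr => i _.
by rewrite big_cons exprS; ring.
Qed.

(** The terms are nonnegative and sum to zero. Thus a product of at most three factors that has the
    sign of [w] everywhere must vanish wherever [w] does not. *)
Lemma affine_dep_ge0 w (s : seq V) a : affine_dep w -> (size s < 4)%N ->
    (forall i, 0 <= w i * \prod_(j <- s) (t j - t i)) ->
  w a * \prod_(j <- s) (t j - t a) = 0.
Proof.
move=> dep ss ge0; apply: (psumr_eq0P (P := predT) (F := fun i =>
  w i * \prod_(j <- s) (t j - t i))) => //.
rewrite -[RHS](@affine_dep_prod w s 0) //.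
by apply: eq_bigr => i _; rewrite expr0 mul1r.
Qed.

Lemma next_index (P : pred V) a :
  (exists b, [/\ (a < b)%N, P b & forall i, (a < i < b)%N -> ~~ P i]) \/
  (forall i, (a < i)%N -> ~~ P i).
Proof.
have [/existsP[b0 Pb0]|nP] := boolP [exists b : V, (a < b)%N && P b]; last first.
  by right=> i ai; move: nP; rewrite negb_exists => /forallP/(_ i); rewrite ai.
left; case: (@arg_minnP _ b0 (fun b : V => (a < b)%N && P b) (@nat_of_ord _) Pb0).
move=> b /andP[ab Pb] minb; exists b; split=> // i /andP[ai ib].
by apply/negP => Pi; have := minb i; rewrite ai Pi => /(_ isT); ord_lia.
Qed.

Definition alternates w := exists a b c d e,
  [/\ [&& a < b, b < c, c < d & d < e]%N, 0 < w a /\ w b < 0, 0 < w c, w d < 0 & 0 < w e].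

(* If [w] has at most three sign changes, a product of factors [t j - x] over
   the places [j] of the changes has the sign of [w] everywhere. *)
Lemma affine_dep_alternates_from w a : affine_dep w ->
  0 < w a -> (forall i, (i < a)%N -> w i = 0) -> alternates w.
Proof.
move=> dep wa wlt.
have tge i j : (i <= j)%N -> 0 <= t j - t i by move=> ij; rewrite subr_ge0 le_param.
have tle i j : (j <= i)%N -> t j - t i <= 0 by move=> ij; rewrite subr_le0 le_param.
have tgt i j : (i < j)%N -> 0 < t j - t i by move=> ij; rewrite subr_gt0 ht.
have [[b [ab wb nb]]|nb] := next_index (fun i => w i < 0) a; last first.
  have := @affine_dep_ge0 w [::] a dep isT; rewrite !big_nil mulr1 => w0.
  suff: w a = 0 by move=> wa0; rewrite wa0 ltxx in wa.
  apply: w0 => i; rewrite big_nil mulr1.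
  have [/wlt->//|/nb|/val_inj->] := ltngtP i a; last exact: ltW.
  by rewrite -leNgt.
have w_ab i : (i < b)%N -> 0 <= w i.
  move=> ib; have [/wlt->//|ai|/val_inj->] := ltngtP i a; last exact: ltW.
  by rewrite leNgt nb ?ai.
have [[c [bc wc nc]]|nc] := next_index (fun i => 0 < w i) b; last first.
  have := @affine_dep_ge0 w [:: b] a dep isT; rewrite !big_cons !big_nil mulr1.
  suff nn i : 0 <= w i * \prod_(j <- [:: b]) (t j - t i).
    by move/(_ nn)/eqP; rewrite gt_eqF// mulr_gt0// tgt.
  rewrite big_cons big_nil mulr1.
  have [ib|bi|/val_inj->] := ltngtP i b; last by rewrite subrr mulr0.
    by rewrite mulr_ge0 ?w_ab ?tge// ltnW.
  by rewrite mulr_le0 ?tle ?(ltnW bi)// leNgt nc.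
have w_bc i : (b <= i < c)%N -> w i <= 0.
  case/andP=> bi ic; have [bi'||/val_inj<-] := ltngtP b i; last exact: ltW.
    by rewrite leNgt nc ?bi'.
  by rewrite ltnNge bi.
have [[d [cd wd nd]]|nd] := next_index (fun i => w i < 0) c; last first.
  have := @affine_dep_ge0 w [:: b; c] a dep isT; rewrite !big_cons !big_nil mulr1.
  suff nn i : 0 <= w i * \prod_(j <- [:: b; c]) (t j - t i).
    by move/(_ nn)/eqP; rewrite gt_eqF// !mulr_gt0// tgt//; ord_lia.
  rewrite !big_cons big_nil mulr1.
  have [ib|bi] := ltnP i b.
    by rewrite !mulr_ge0 ?w_ab ?tge//; ord_lia.
  have [ic|ci] := ltnP i c.
    by rewrite mulr_le0 ?w_bc ?bi// mulr_le0_ge0 ?tle ?tge//; ord_lia.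
  rewrite mulr_ge0//; last by rewrite mulr_le0 ?tle//; ord_lia.
  have [ci'||/val_inj<-] := ltngtP c i; [|by rewrite ltnNge ci|exact: ltW].
  by rewrite leNgt nd.
have w_cd i : (c <= i < d)%N -> 0 <= w i.
  case/andP=> ci id; have [ci'||/val_inj<-] := ltngtP c i; last exact: ltW.
    by rewrite leNgt nd ?ci'.
  by rewrite ltnNge ci.
have [[e [de we ne]]|ne] := next_index (fun i => 0 < w i) d; last first.
  have := @affine_dep_ge0 w [:: b; c; d] a dep isT; rewrite !big_cons !big_nil mulr1.
  suff nn i : 0 <= w i * \prod_(j <- [:: b; c; d]) (t j - t i).
    by move/(_ nn)/eqP; rewrite gt_eqF// !mulr_gt0// tgt//; ord_lia.
  rewrite !big_cons big_nil mulr1.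
  have [ib|bi] := ltnP i b.
    by rewrite !mulr_ge0 ?w_ab ?tge//; ord_lia.
  have [ic|ci] := ltnP i c.
    by rewrite mulr_le0 ?w_bc ?bi// mulr_le0_ge0 ?mulr_ge0 ?tle ?tge//; ord_lia.
  have [id|di] := ltnP i d.
    rewrite mulr_ge0 ?w_cd ?ci//.
    by rewrite mulr_le0 ?mulr_le0_ge0 ?tle ?tge//; ord_lia.
  rewrite mulr_le0//; last by rewrite mulr_le0_ge0 ?mulr_le0 ?tle//; ord_lia.
  have [di'||/val_inj<-] := ltngtP d i; [|by rewrite ltnNge di|exact: ltW].
  by rewrite leNgt ne.
by exists a, b, c, d, e; split=> //; rewrite ab bc cd.
Qed.

Lemma affine_dep_alternates w i : affine_dep w -> w i != 0 ->
  alternates w \/ alternates (fun i => - w i).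
Proof.
move=> dep wi.
case: (@arg_minnP _ i (fun i => w i != 0) (@nat_of_ord _) wi) => a wa mina.
have wlt j : (j < a)%N -> w j = 0.
  by move=> ja; apply/eqP/negPn/negP => /mina; rewrite leqNgt ja.
have [wa_gt|wa_lt|wa0] := ltgtP 0 (w a); last by rewrite -wa0 eqxx in wa.
  by left; apply: (@affine_dep_alternates_from w a).
right; apply: (@affine_dep_alternates_from _ a); rewrite ?oppr_gt0 //.
  move=> k k4; rewrite -[RHS]oppr0 -[X in - X](dep k k4) -sumrN.
  by apply: eq_bigr => j _; rewrite mulNr.
by move=> j /wlt ->; rewrite oppr0.
Qed.

Lemma affine_depP w : affine_dep w <->
  \sum_i w i = 0 /\ \sum_i w i *: vertex_pt t i = 0.
Proof.
split=> [dep | [w0 w1]].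
  split; first by rewrite -[RHS](dep 0) //; apply: eq_bigr => i _; rewrite mulr1.
  apply/rowP => j; rewrite summxE mxE -[RHS](dep j.+1); last by have := ltn_ord j.
  by apply: eq_bigr => i _; rewrite !mxE.
case=> [_|k k4]; first by rewrite -[RHS]w0; apply: eq_bigr => i _; rewrite mulr1.
have := congr1 (fun x : 'rV_3 => x 0 (Ordinal (k4 : (k < 3)%N))) w1.
by rewrite summxE mxE => {2}<-; apply: eq_bigr => i _; rewrite !mxE.
Qed.

Definition weights S lam :=
  [/\ forall i, 0 <= lam i, forall i, i \notin S -> lam i = 0 & \sum_i lam i = 1].

(** Not symmetric: the triangle comes from [S], the edge from [U]. Such alternating pairs are the
    minimal Radon partitions of points on the moment curve. *)
Definition crosses S U := exists a b c d e,
  [/\ [&& a < b, b < c, c < d & d < e]%N, [/\ a \in S, c \in S & e \in S]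
    & b \in U /\ d \in U].

Lemma weights_supp S lam i : weights S lam -> 0 < lam i -> i \in S.
Proof. by case=> _ supp _; apply: contraTT => /supp ->; rewrite ltxx. Qed.

(** The difference [lam - mu] is an affine dependency, positive only on [S] and negative only on
    [U]. If nonzero, its alternating signs exhibit a crossing. *)
Lemma weights_uniq S U lam mu : weights S lam -> weights U mu ->
    \sum_i lam i *: vertex_pt t i = \sum_i mu i *: vertex_pt t i ->
  [\/ lam =1 mu, crosses S U | crosses U S].
Proof.
move=> wl wm eq_pt.
have [/forallP eq|] := boolP [forall i, lam i == mu i].
  by apply: Or31 => i; apply/eqP.
rewrite negb_forall => /existsP[i ne_i].
have dep : affine_dep (fun i => lam i - mu i).
  apply/affine_depP; case: wl wm => [_ _ sl] [_ _ sm].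
  rewrite sumrB sl sm subrr; split=> //.
  rewrite -[RHS](subrr (\sum_i mu i *: vertex_pt t i)) -{1}eq_pt -sumrB.
  by apply: eq_bigr => j _; rewrite scalerBl.
have lamS j : 0 < lam j - mu j -> j \in S.
  rewrite subr_gt0 => lt; apply: (weights_supp wl); apply: le_lt_trans lt.
  by case: wm.
have muU j : lam j - mu j < 0 -> j \in U.
  rewrite subr_lt0 => lt; apply: (weights_supp wm); apply: le_lt_trans lt.
  by case: wl.
have ni : lam i - mu i != 0 by rewrite subr_eq0.
have [] := affine_dep_alternates (i := i) dep ni.
  case=> a [b [c [d [e [lt [wa wb] wc wd we]]]]]; apply: Or32.
  by exists a, b, c, d, e; split=> //; split; auto.
case=> a [b [c [d [e [lt]]]]]; rewrite !oppr_gt0 !oppr_lt0.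
by case=> wa wb wc wd we; apply: Or33; exists a, b, c, d, e; split=> //; split; auto.
Qed.

End Geometry.

(** * Triangulations as noncrossing covers *)

Section Triangulations.
Variables (R : realFieldType) (n : nat) (t : 'I_n.+2 -> R).
Hypothesis ht : forall i j : 'I_n.+2, (i < j)%N -> t i < t j.
Local Notation V := 'I_n.+2.
Implicit Types (i a b c d e : V) (w lam mu : V -> R) (S U : {set V}) (T : {set {set V}}).

(** A matrix with five rows and four columns has a nonzero left kernel vector. As a dependency
    supported on five points, it needs all five to alternate, so its signs are known up to
    negation. *)
Lemma alternating_dep (v1 v2 v3 v4 v5 : V) :
    [&& v1 < v2, v2 < v3, v3 < v4 & v4 < v5]%N ->
  exists w, [/\ affine_dep t w, [/\ 0 < w v1, 0 < w v3 & 0 < w v5],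
    w v2 < 0 /\ w v4 < 0 & forall i, i \notin [:: v1; v2; v3; v4; v5] -> w i = 0].
Proof.
move=> lt; pose v (j : 'I_5) : V := nth v1 [:: v1; v2; v3; v4; v5] j.
have v_lt (j k : 'I_5) : (j < k)%N -> (v j < v k)%N.
  by case: j k => -[|[|[|[|[|?]]]]] ? [] [|[|[|[|[|?]]]]] ? //=; rewrite /v /=; ord_lia.
have v_inj : injective v.
  move=> j k eq_v; apply: val_inj; have := @v_lt j k; have := @v_lt k j.
  by rewrite eq_v /=; ord_lia.
pose M : 'M[R]_(5, 4) := \matrix_(j, k) t (v j) ^+ k.
have kM : kermx M != 0.
  by rewrite -mxrank_eq0 mxrank_ker; have := rank_leq_col M; lia.
have [u /sub_kermxP uM u_nz] := rowV0Pn kM.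
pose w i := \sum_(j < 5) (v j == i)%:R * u 0 j.
have wv j : w (v j) = u 0 j.
  rewrite /w (bigD1 j) //= eqxx mul1r big1 ?addr0 // => k kj.
  by rewrite (inj_eq v_inj) (negbTE kj) mul0r.
have dep : affine_dep t w.
  move=> k k4; have := congr1 (fun x : 'rV_4 => x 0 (Ordinal k4)) uM.
  rewrite !mxE => {2}<-; under eq_bigr do rewrite mulr_suml.
  rewrite exchange_big; apply: eq_bigr => j _; rewrite (bigD1 (v j)) //= big1 ?addr0.
    by rewrite eqxx mul1r mxE.
  by move=> i; rewrite eq_sym => /negbTE->; rewrite !mul0r.
have supp i : w i != 0 -> exists j, i = v j.
  move=> wi; have [/existsP[j /eqP <-]|] := boolP [exists j, v j == i]; first by exists j.
  rewrite negb_exists => /forallP nv; case/eqP: wi; rewrite /w big1 // => j _.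
  by rewrite (negbTE (nv j)) mul0r.
have alt w' : (forall i, w' i != 0 -> exists j, i = v j) -> alternates w' ->
    [/\ 0 < w' v1, 0 < w' v3 & 0 < w' v5] /\ (w' v2 < 0 /\ w' v4 < 0).
  move=> supp' [a [b [c [d [e [lt' [wa wb] wc wd we]]]]]].
  have [[ja ea] [jb eb] [jc ec]] : [/\ exists j, a = v j, exists j, b = v j & exists j, c = v j].
    by split; apply: supp'; rewrite ?(gt_eqF wa) ?(lt_eqF wb) ?(gt_eqF wc).
  have [[jd ed] [je ee]] : (exists j, d = v j) /\ (exists j, e = v j).
    by split; apply: supp'; rewrite ?(lt_eqF wd) ?(gt_eqF we).
  have v_mono j k : (v j < v k)%N -> (j < k)%N.
    by rewrite !ltnNge; apply: contraNN; rewrite leq_eqVlt => /orP[/eqP/val_inj->|/v_lt/ltnW].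
  subst a b c d e; case/and4P: lt' => /v_mono ab /v_mono bc /v_mono cd /v_mono de.
  (* Five increasing indices below 5 can only be 0, 1, 2, 3, 4. *)
  have := ltn_ord je => e5.
  have [a0 b1 c2] : [/\ ja = 0%N :> nat, jb = 1%N :> nat & jc = 2%N :> nat] by split; ord_lia.
  have [d3 e4] : jd = 3%N :> nat /\ je = 4%N :> nat by split; ord_lia.
  by move: wa wb wc wd we; rewrite /v a0 b1 c2 d3 e4.
have supp0 i : i \notin [:: v1; v2; v3; v4; v5] -> w i = 0.
  move=> iv; apply/eqP/negPn/negP => /supp[j ei]; case/negP: iv.
  by rewrite ei mem_nth.
have [j uj] : exists j, u 0 j != 0.
  by apply/existsP; apply: contraNT u_nz; rewrite negb_exists => /forallP u0;
     apply/eqP/rowP => j; rewrite mxE; apply/eqP/negPn/u0.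
have wj : w (v j) != 0 by rewrite wv.
have [/alt|/alt] := affine_dep_alternates ht dep wj.
  by case=> // wpos wneg; exists w.
case=> [i|[w1 w3 w5] [w2 w4]]; first by rewrite oppr_eq0; apply: supp.
exists (fun i => - w i); split=> //; last by move=> i /supp0 ->; rewrite oppr0.
move=> k k4; rewrite -[RHS]oppr0 -[X in - X](dep k k4) -sumrN.
by apply: eq_bigr => i _; rewrite mulNr.
Qed.

Lemma convP S x : conv t S x <->
  exists2 lam, weights S lam & x = \sum_i lam i *: vertex_pt t i.
Proof. by split=> [[lam [? ? ? ->]]|[lam [? ? ?] ->]]; exists lam. Qed.

Lemma conv_sub S U x : S \subset U -> conv t S x -> conv t U x.
Proof.
move=> SU [lam [ge0 supp s1 ->]]; exists lam; split=> // i iU; apply: supp.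
by apply: contraNN iU; apply: subsetP.
Qed.

Lemma card_crosses S U : crosses S U -> (4 < #|S :|: U|)%N.
Proof.
case=> a [b [c [d [e [lt [aS cS eS] [bU dU]]]]]].
rewrite -[5%N]/(size [:: a; b; c; d; e]) -(card_uniqP _).
  apply: subset_leq_card; apply/subsetP => x; rewrite !inE.
  by case/or4P => [|||/orP[]] /eqP->; rewrite ?aS ?cS ?eS ?bU ?dU ?orbT.
by rewrite /= !inE -!val_eqE /=; ord_lia.
Qed.

(** The positive and negative parts of [w] have the same total [s]; divided by [s], they become two
    convex combinations for one point, a Radon point. *)
Lemma dep_weights w a : affine_dep t w -> 0 < w a ->
  exists lam mu, [/\ weights [set i | 0 < w i] lam, weights [set i | w i < 0] mu,
    \sum_i lam i *: vertex_pt t i = \sum_i mu i *: vertex_pt t i,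
    forall i, 0 < w i -> 0 < lam i & forall i, w i < 0 -> 0 < mu i].
Proof.
move=> /affine_depP[w0 wpt] wa.
pose pos i := Num.max (w i) 0; pose neg i := Num.max (- w i) 0.
have pos_ge0 i : 0 <= pos i by rewrite le_max lexx orbT.
have neg_ge0 i : 0 <= neg i by rewrite le_max lexx orbT.
have wE i : w i = pos i - neg i by rewrite /pos /neg /Num.max; do 2!case: ltP => ?; lra.
pose s := \sum_i pos i.
have s_gt0 : 0 < s.
  rewrite /s (bigD1 a) //= ltr_wpDr ?sumr_ge0 //.
  by rewrite lt_max wa.
have s_neg : \sum_i neg i = s.
  by apply/esym/eqP; rewrite -subr_eq0 -sumrB -[X in _ == X]w0; apply/eqP/eq_bigr.
exists (fun i => s^-1 * pos i), (fun i => s^-1 * neg i); split.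
- split=> [i|i|]; first by rewrite mulr_ge0 // invr_ge0 ltW.
    by rewrite inE -leNgt /pos => /max_r ->; rewrite mulr0.
  by rewrite -mulr_sumr mulVf // gt_eqF.
- split=> [i|i|]; first by rewrite mulr_ge0 // invr_ge0 ltW.
    by rewrite inE -leNgt /neg => wi; rewrite max_r ?mulr0 ?oppr_le0.
  by rewrite -mulr_sumr s_neg mulVf // gt_eqF.
- apply/eqP; rewrite -subr_eq0 -sumrB; apply/eqP.
  transitivity (s^-1 *: \sum_i w i *: vertex_pt t i); last by rewrite wpt scaler0.
  by rewrite scaler_sumr; apply: eq_bigr => i _; rewrite -scalerBl -mulrBr -wE scalerA.
- by move=> i wi; rewrite mulr_gt0 ?invr_gt0 // lt_max wi.
- by move=> i wi; rewrite mulr_gt0 ?invr_gt0 // lt_max oppr_gt0 wi.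
Qed.

Lemma weights_sub S U lam : S \subset U -> weights S lam -> weights U lam.
Proof.
move=> SU [ge0 supp s1]; split=> // i iU; apply: supp.
by apply: contraNN iU; apply: subsetP.
Qed.

Lemma weights_vertex a : weights [set a] (fun i => (i == a)%:R : R) /\
  \sum_i (i == a)%:R *: vertex_pt t i = vertex_pt t a.
Proof.
split; first split=> [i|i|]; first exact: ler0n.
- by rewrite inE => /negbTE->.
- by rewrite (bigD1 a) //= eqxx big1 ?addr0 // => i /negbTE->.
by rewrite (bigD1 a) //= eqxx scale1r big1 ?addr0 // => i /negbTE->; rewrite scale0r.
Qed.

Lemma crosses_irr S : #|S| = 4 -> ~ crosses S S.
Proof. by move=> S4 /card_crosses; rewrite setUid S4. Qed.

Lemma weights_simplex_uniq S lam mu : #|S| = 4 -> weights S lam -> weights S mu ->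
  \sum_i lam i *: vertex_pt t i = \sum_i mu i *: vertex_pt t i -> lam =1 mu.
Proof.
by move=> S4 wl wm eq_pt; have [|/crosses_irr|/crosses_irr] := weights_uniq ht wl wm eq_pt;
  rewrite ?S4.
Qed.

Lemma conv_vertex B a : conv t B (vertex_pt t a) -> a \in B.
Proof.
case/convP=> mu wmu; have [wa <-] := weights_vertex a => eq_pt.
have [eq|cr|cr] := weights_uniq ht wa wmu eq_pt.
- by apply: (weights_supp wmu); rewrite -eq eqxx.
- case: cr => x [b [c [d [e [lt [+ + _] _]]]]]; rewrite !inE => /eqP ? /eqP ?.
  by subst; ord_lia.
case: cr => x [b [c [d [e [lt _ []]]]]]; rewrite !inE => /eqP ? /eqP ?.
by subst; ord_lia.
Qed.

(** The Radon point of a crossing lies in both simplices. By uniqueness of barycentric coordinates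
    the common face [A] contains [a], [c], [e], and its vertices lie in [B], hence in [U]. Then [U]
    would have five vertices. *)
Lemma common_face_noncrossing S U : #|S| = 4 -> #|U| = 4 ->
  common_face t S U -> ~ crosses S U.
Proof.
move=> S4 U4 [A [B [AS BU convA convB]]] [a [b [c [d [e [lt [aS cS eS] [bU dU]]]]]]].
have [w [dep [wa wc we] [wb wd] supp]] := alternating_dep lt.
have [lam [mu [wlam wmu eq_pt lam_gt0 mu_gt0]]] := dep_weights dep wa.
have wlamS : weights S lam.
  apply: weights_sub wlam; apply/subsetP => i; rewrite inE => wi.
  have : i \in [:: a; b; c; d; e].
    by apply/negPn/negP => /supp wi0; rewrite wi0 ltxx in wi.
  rewrite !inE; case/or4P => [|||/orP[]] /eqP ei //; subst i => //.
    by rewrite ltNge (ltW wb) in wi.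
  by rewrite ltNge (ltW wd) in wi.
have wmuU : weights U mu.
  apply: weights_sub wmu; apply/subsetP => i; rewrite inE => wi.
  have : i \in [:: a; b; c; d; e].
    by apply/negPn/negP => /supp wi0; rewrite wi0 ltxx in wi.
  rewrite !inE; case/or4P => [|||/orP[]] /eqP ei //; subst i => //.
  - by rewrite ltNge (ltW wa) in wi.
  - by rewrite ltNge (ltW wc) in wi.
  by rewrite ltNge (ltW we) in wi.
pose x := \sum_i lam i *: vertex_pt t i.
have xSU : conv t S x /\ conv t U x.
  by split; apply/convP; [exists lam | exists mu].
have [lam' wlam' eqA] : exists2 lam', weights A lam' &
  x = \sum_i lam' i *: vertex_pt t i by apply/convP/convA.
have [mu' wmu' eqB] : exists2 mu', weights B mu' &
  x = \sum_i mu' i *: vertex_pt t i by apply/convP/convB.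
have lamE := weights_simplex_uniq S4 wlamS (weights_sub AS wlam') eqA.
have muE := weights_simplex_uniq U4 wmuU (weights_sub BU wmu') (etrans (esym eq_pt) eqB).
have inA i : 0 < w i -> i \in A.
  by move=> /lam_gt0 lam_i; apply: (weights_supp wlam'); rewrite -lamE.
have AB i : i \in A -> i \in B.
  move=> iA; apply: conv_vertex; apply/convB/convA/convP.
  have [wi pt_i] := weights_vertex i; exists (fun j => (j == i)%:R) => //.
  by apply: weights_sub wi; rewrite sub1set.
apply: (crosses_irr U4); exists a, b, c, d, e; split=> //.
by split; apply: (subsetP BU); apply/AB/inA.
Qed.

(* Geometric triangulations in combinatorial terms: by [weights_uniq], two
   simplices meet badly exactly when a triangle of one crosses an edge of the other. *)
Definition noncrossing_cover T := [/\ forall S, S \in T -> #|S| = 4,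
  forall S U, S \in T -> U \in T -> ~ crosses S U
  & forall x, cyclic_polytope t x -> exists2 S, S \in T & conv t S x].

(** For the converse, the common face is [S :&: U]: without crossings, the weights of a common point
    in [S] and in [U] agree, so they vanish outside both. *)
Lemma triangulationP T : triangulation t T <-> noncrossing_cover T.
Proof.
split=> [[T4 cov sub face] | [T4 nc cov]]; split=> //.
- by move=> S U ST UT; apply: common_face_noncrossing (face _ _ ST UT); apply: T4.
- by move=> S _ x; apply: conv_sub; apply: subsetT.
move=> S U ST UT; suff fc x : conv t S x /\ conv t U x <-> conv t (S :&: U) x.
  by exists (S :&: U), (S :&: U); rewrite subsetIl subsetIr.
split=> [[/convP[lam wl ->] /convP[mu wm eq_pt]] | xSU]; last first.
  by split; apply: conv_sub xSU; rewrite ?subsetIl ?subsetIr.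
have [lamE|/nc[]|/nc[]] // := weights_uniq ht wl wm eq_pt.
apply/convP; exists lam => //; have [ge0 _ s1] := wl; split=> // i.
have [+ + _] := wl; have [_ + _] := wm => suppU _ suppS.
by rewrite inE negb_and => /orP[/suppS | /suppU <-].
Qed.

(** Apply [weights_uniq] to the barycentre of [A] and a simplex [U] covering it: if the weights
    agree, they are positive on all of [A], so [A] lies in [U]. *)
Lemma cover_subset T A : noncrossing_cover T -> A != set0 ->
  exists2 U, U \in T & [\/ A \subset U, crosses A U | crosses U A].
Proof.
case=> _ _ cov A_nz; pose lam i := (i \in A)%:R / #|A|%:R : R.
have A_gt0 : (0 < #|A|%:R :> R) by rewrite ltr0n card_gt0.
have wlam : weights A lam.
  split=> [i|i|]; first by rewrite divr_ge0 ?ler0n.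
    by rewrite /lam => /negbTE ->; rewrite mul0r.
  rewrite -mulr_suml -natr_sum -[RHS](divff (lt0r_neq0 A_gt0)); congr (_%:R / _).
  by rewrite -sum1_card [RHS]big_mkcond; apply: eq_bigr => i _; case: (i \in A).
have [|U UT] := cov (\sum_i lam i *: vertex_pt t i).
  by apply: (conv_sub (subsetT A)); apply/convP; exists lam.
case/convP=> mu wmu eq_pt; exists U => //.
have [lamE|cr|cr] := weights_uniq ht wlam wmu eq_pt; [apply: Or31|exact: Or32|exact: Or33].
apply/subsetP => i iA; apply: (weights_supp wmu).
by rewrite -lamE /lam iA divr_gt0.
Qed.

End Triangulations.

(** * Bistellar flips *)

Ltac decide_subset :=
  apply/subsetP => ?; rewrite !inE;
  repeat match goal with |- context [?x == ?y] => case: (x == y) end.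

Section Faces.
Variable n : nat.
Local Notation V := 'I_n.+2.
Implicit Types (a b c d e x y : V) (S U A B : {set V}) (T : {set {set V}}).

Definition face T A := [exists S in T, A \subset S].

Definition edge T : rel V := fun x y => [set x; y] \in F1 T.

Lemma edge_face T x y : (x < y)%N -> edge T x y = face T [set x; y].
Proof. by move=> xy; rewrite /edge inE cards2 -val_eqE neq_ltn xy. Qed.

Lemma faceI T S A : S \in T -> A \subset S -> face T A.
Proof. by move=> ST AS; apply/exists_inP; exists S. Qed.

Lemma noncrossing_face T a b c d e : (forall S U, S \in T -> U \in T -> ~ crosses S U) ->
  [&& a < b, b < c, c < d & d < e]%N -> face T [set a; c; e] -> ~ face T [set b; d].
Proof.
move=> nc lt /exists_inP[S ST aceS] /exists_inP[U UT bdU].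
apply: (nc S U ST UT); exists a, b, c, d, e; split=> //.
  by split; apply: (subsetP aceS); rewrite !inE eqxx ?orbT.
by split; apply: (subsetP bdU); rewrite !inE eqxx ?orbT.
Qed.

Lemma card_le_size A (s : seq V) : {subset A <= s} -> (#|A| <= size s)%N.
Proof. by move=> /subsetP/subset_leq_card/leq_trans-> //; apply: card_size. Qed.

Lemma card_quad a b c d : [&& a < b, b < c & c < d]%N -> #|[set a; b; c; d]| = 4.
Proof.
move=> lt; rewrite -[RHS]/(size [:: a; b; c; d]) -(card_uniqP _).
  by apply: eq_card => x; rewrite !inE -!orbA.
by rewrite /= !inE -!val_eqE /=; ord_lia.
Qed.

Lemma card_triple a b c : (a < b)%N -> (b < c)%N -> #|[set a; b; c]| = 3.
Proof.
move=> ab bc; rewrite -[RHS]/(size [:: a; b; c]) -(card_uniqP _).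
  by apply: eq_card => x; rewrite !inE -!orbA.
by rewrite /= !inE -!val_eqE /=; ord_lia.
Qed.

Lemma subset_drop A S U x : A \subset S -> x \notin A -> S :\ x \subset U -> A \subset U.
Proof. by move=> AS xA; apply: subset_trans; rewrite subsetD1 AS. Qed.

End Faces.

(** * Faces before and after a flip *)

Section Flip.
Variables (n : nat) (v1 v2 v3 v4 v5 : 'I_n.+2).
Local Notation V := 'I_n.+2.
Implicit Types (x y : V) (S U A B : {set V}) (T : {set {set V}}).
Hypothesis lt_v : [&& v1 < v2, v2 < v3, v3 < v4 & v4 < v5]%N.
Let low := Tlow v1 v2 v3 v4 v5.
Let up := Tup v1 v2 v3 v4 v5.

(** Dropping [v1], [v3] or [v5] from an upper simplex leaves a set inside some lower simplex. *)
Lemma Tup_face A S : S \in up -> A \subset S -> ~~ ([set v1; v3; v5] \subset A) -> face low A.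
Proof.
rewrite !subUset !sub1set !negb_and.
have face1 B : B \subset [set v1; v2; v4; v5] -> face low B.
  by apply: faceI; rewrite !inE eqxx.
have face2 B : B \subset [set v1; v2; v3; v4] -> face low B.
  by apply: faceI; rewrite !inE eqxx orbT.
have face3 B : B \subset [set v2; v3; v4; v5] -> face low B.
  by apply: faceI; rewrite !inE eqxx orbT.
rewrite !inE => /orP[] /eqP-> AS /orP[/orP[]|] vA;
  first [by apply: face1; apply: (subset_drop AS vA); decide_subset
     |by apply: face2; apply: (subset_drop AS vA); decide_subset
     |by apply: face3; apply: (subset_drop AS vA); decide_subset].
Qed.

Lemma Tlow_face A S : S \in low -> A \subset S -> ~~ ([set v2; v4] \subset A) -> face up A.
Proof.
rewrite !subUset !sub1set !negb_and.
have face1 B : B \subset [set v1; v2; v3; v5] -> face up B.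
  by apply: faceI; rewrite !inE eqxx.
have face2 B : B \subset [set v1; v3; v4; v5] -> face up B.
  by apply: faceI; rewrite !inE eqxx orbT.
by rewrite !inE => /orP[/orP[]|] /eqP-> AS /orP[] vA;
  [apply: face2|apply: face1|apply: face2|apply: face1|apply: face2|apply: face1];
  apply: (subset_drop AS vA); decide_subset.
Qed.

Variable T : {set {set V}}.
Hypothesis T4 : forall S, S \in T -> #|S| = 4.
Hypothesis ncT : forall S U, S \in T -> U \in T -> ~ crosses S U.
Hypothesis lowT : low \subset T.
Let T' := (T :\: low) :|: up.

Lemma face_low A : [|| A \subset [set v1; v2; v4; v5], A \subset [set v1; v2; v3; v4]
  | A \subset [set v2; v3; v4; v5]] -> face T A.
Proof.
by case/or3P => AS; apply: faceI AS; apply: (subsetP lowT); rewrite !inE eqxx ?orbT.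
Qed.

(** A further vertex [x] of [U], wherever it lies in the order, would make a face of [x v2 v4] cross
    a face of a lower simplex. The quadruples of the five vertices that contain [v2] and [v4] are
    just the lower simplices. *)
Lemma star_low U : U \in T -> v2 \in U -> v4 \in U -> U \in low.
Proof.
move=> UT v2U v4U.
have faceU A : A \subset U -> face T A by apply: faceI UT.
have sub x : x \in U -> x \in [:: v1; v2; v3; v4; v5].
  move=> xU; apply/negPn/negP => xv.
  have fx A : A \subset [set x; v2; v4] -> face T A.
    move=> Ax; apply/faceU/(subset_trans Ax).
    by rewrite !subUset !sub1set xU v2U v4U.
  have {xv} ne : [&& x != v1 :> nat, x != v2 :> nat, x != v3 :> nat, x != v4 :> nat
    & x != v5 :> nat] by move: xv; rewrite !inE !negb_or.
  have cross := noncrossing_face ncT.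
  have [xv1|v1x] := ltnP x v1.
    by apply: (cross x v1 v2 v3 v4); [ord_lia | apply: fx | apply: face_low];
      rewrite !subUset !sub1set !inE !eqxx ?orbT.
  have [xv2|v2x] := ltnP x v2.
    by apply: (cross v1 x v2 v4 v5); [ord_lia | apply: face_low | apply: fx];
      rewrite !subUset !sub1set !inE !eqxx ?orbT.
  have [xv3|v3x] := ltnP x v3.
    by apply: (cross v2 x v3 v4 v5); [ord_lia | apply: face_low | apply: fx];
      rewrite !subUset !sub1set !inE !eqxx ?orbT.
  have [xv4|v4x] := ltnP x v4.
    by apply: (cross v1 v2 v3 x v4); [ord_lia | apply: face_low | apply: fx];
      rewrite !subUset !sub1set !inE !eqxx ?orbT.
  have [xv5|v5x] := ltnP x v5.
    by apply: (cross v1 v2 v4 x v5); [ord_lia | apply: face_low | apply: fx];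
      rewrite !subUset !sub1set !inE !eqxx ?orbT.
  by apply: (cross v2 v3 v4 v5 x); [ord_lia | apply: fx | apply: face_low];
    rewrite !subUset !sub1set !inE !eqxx ?orbT.
have quad S : #|S| = 4 -> S \subset U -> U = S.
  by move=> S4 SU; apply/esym/eqP; rewrite eqEcard SU S4 T4.
have small z : ~ {subset U <= [:: v2; v4; z]}.
  by move/card_le_size; rewrite T4.
rewrite !inE; have [v1U|v1U] := boolP (v1 \in U); have [v5U|v5U] := boolP (v5 \in U).
- apply/orP; left; apply/orP; left; apply/eqP/quad; first by apply: card_quad; ord_lia.
  by rewrite !subUset !sub1set v1U v2U v4U.
- apply/orP; left; apply/orP; right; apply/eqP/quad; first by apply: card_quad; ord_lia.
  rewrite !subUset !sub1set v1U v2U v4U /= andbT; apply/negPn/negP => v3U.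
  apply: (small v1) => x xU; move: (sub x xU) (xU); rewrite !inE.
  by case/or4P => [|||/orP[]] /eqP->; rewrite ?eqxx ?orbT // (negbTE v3U, negbTE v5U).
- apply/orP; right; apply/eqP/quad; first by apply: card_quad; ord_lia.
  rewrite !subUset !sub1set v5U v2U v4U /= !andbT; apply/negPn/negP => v3U.
  apply: (small v5) => x xU; move: (sub x xU) (xU); rewrite !inE.
  by case/or4P => [|||/orP[]] /eqP->; rewrite ?eqxx ?orbT // (negbTE v3U, negbTE v1U).
case: (small v3) => x xU; move: (sub x xU) (xU); rewrite !inE.
by case/or4P => [|||/orP[]] /eqP->; rewrite ?eqxx ?orbT // (negbTE v1U, negbTE v5U).
Qed.

Lemma flip_star U : U \in T' -> ~~ ([set v2; v4] \subset U).
Proof.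
rewrite subUset !sub1set in_setU in_setD => /orP[/andP[Ulow UT]|].
  by apply: contra Ulow => /andP[v2U v4U]; apply: star_low.
by rewrite !inE => /orP[] /eqP->; rewrite !inE -!val_eqE /=; ord_lia.
Qed.

Lemma flip_face A : face T' A -> ~~ ([set v1; v3; v5] \subset A) -> face T A.
Proof.
case/exists_inP=> S; rewrite in_setU in_setD => /orP[/andP[_ ST]|Sup] AS Av.
  exact: faceI AS.
have /exists_inP[S' S'low] := Tup_face Sup AS Av.
by apply: faceI; apply: (subsetP lowT).
Qed.

Lemma flip_card S : S \in T' -> #|S| = 4.
Proof.
rewrite in_setU in_setD => /orP[/andP[_ /T4] //|].
by rewrite !inE => /orP[] /eqP->; apply: card_quad; ord_lia.
Qed.

(** The edge [b d] is already a face of [T], so the triangle [a c e] must be the new one,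
    [v1 v3 v5]. Then [b d] crosses a lower triangle unless it is [v2 v4], which [flip_star]
    excludes. *)
Lemma flip_noncrossing S U : S \in T' -> U \in T' -> ~ crosses S U.
Proof.
move=> ST UT [a [b [c [d [e [lt [aS cS eS] [bU dU]]]]]]].
have bd_U : [set b; d] \subset U by rewrite subUset !sub1set bU dU.
have bdT : face T [set b; d].
  apply: flip_face; first exact: faceI UT bd_U.
  by apply/negP => /subset_leq_card; rewrite cards2 card_triple; ord_lia.
have ace_T' : face T' [set a; c; e].
  by apply: (faceI ST); rewrite !subUset !sub1set aS cS eS.
have cross := noncrossing_face ncT.
have [|ace] := boolP ([set v1; v3; v5] \subset [set a; c; e]); last first.
  by apply: (cross a b c d e lt) => //; apply: flip_face ace_T' ace.
rewrite !subUset !sub1set !inE -!val_eqE /= => ace.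
have {}lt : [&& v1 < b, b < v3, v3 < d & d < v5]%N by ord_lia.
have [bv2|v2b|/val_inj b2] := ltngtP b v2.
- by apply: (cross v1 b v2 d v5) => //; [ord_lia | apply: face_low];
    rewrite !subUset !sub1set !inE !eqxx ?orbT.
- by apply: (cross v2 b v3 d v5) => //; [ord_lia | apply: face_low];
    rewrite !subUset !sub1set !inE !eqxx ?orbT.
subst b; have [dv4|v4d|/val_inj d4] := ltngtP d v4.
- by apply: (cross v1 v2 v3 d v4) => //; [ord_lia | apply: face_low];
    rewrite !subUset !sub1set !inE !eqxx ?orbT.
- by apply: (cross v1 v2 v4 d v5) => //; [ord_lia | apply: face_low];
    rewrite !subUset !sub1set !inE !eqxx ?orbT.
by subst d; have := flip_star UT; rewrite bd_U.
Qed.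

Lemma flip_F1 : F1 T' = F1 T :\ [set v2; v4].
Proof.
apply/setP => A; rewrite in_setD1 !inE.
have [A2 /=|_] := boolP (#|A| == 2); last by rewrite andbF.
have v24 : #|[set v2; v4]| = 2 by rewrite cards2 -val_eqE /= neq_ltn; ord_lia.
apply/idP/idP => [AT'|/andP[Av AT]].
  apply/andP; split.
    apply: contraTneq AT' => ->; rewrite negb_exists; apply/forallP => U.
    by rewrite negb_and -implybE; apply/implyP/flip_star.
  apply: flip_face AT' _; apply/negP => /subset_leq_card.
  by rewrite (eqP A2) card_triple //; ord_lia.
have {Av} Av : ~~ ([set v2; v4] \subset A).
  by apply: contraNN Av => Av; rewrite eq_sym eqEcard Av (eqP A2) v24.
case/exists_inP: AT => S ST AS.
have [Slow|Slow] := boolP (S \in low); last first.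
  by apply: (faceI _ AS); rewrite in_setU in_setD Slow ST.
have /exists_inP[S' S'up] := Tlow_face Slow AS Av.
by apply: faceI; rewrite in_setU S'up orbT.
Qed.

Lemma flip_diagonal : [set v2; v4] \in F1 T.
Proof.
rewrite inE cards2 -val_eqE /= neq_ltn; apply/andP; split; first by ord_lia.
by apply: face_low; rewrite !subUset !sub1set !inE !eqxx ?orbT.
Qed.

End Flip.

(** * Edges and the order *)

Section FlipOrder.
Variables (R : realFieldType) (n : nat) (t : 'I_n.+2 -> R).
Hypothesis ht : forall i j : 'I_n.+2, (i < j)%N -> t i < t j.
Local Notation V := 'I_n.+2.
Implicit Types (a b c d e i x y : V) (S U A : {set V}) (T : {set {set V}}).

Lemma flip_noncrossing_cover (v1 v2 v3 v4 v5 : V) T :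
    [&& v1 < v2, v2 < v3, v3 < v4 & v4 < v5]%N ->
    noncrossing_cover t T -> Tlow v1 v2 v3 v4 v5 \subset T ->
  noncrossing_cover t ((T :\: Tlow v1 v2 v3 v4 v5) :|: Tup v1 v2 v3 v4 v5).
Proof.
move=> lt [T4 nc cov] lowT; split; first exact: flip_card.
  exact: flip_noncrossing.
move=> x /cov[S ST xS].
have [Slow|Slow] := boolP (S \in Tlow v1 v2 v3 v4 v5); last first.
  by exists S => //; rewrite in_setU in_setD Slow ST.
have {xS} /convP[lam [lam_ge0 lam_supp lam1] ->] : conv t [set v1; v2; v3; v4; v5] x.
  apply: conv_sub xS; move: Slow; rewrite !inE => /orP[/orP[]|] /eqP->;
    by decide_subset.
suff [S' S'up xS'] : exists2 S', S' \in Tup v1 v2 v3 v4 v5 &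
    conv t S' (\sum_i lam i *: vertex_pt t i).
  by exists S' => //; rewrite in_setU S'up orbT.
have [w [dep [w1 w3 w5] [w2 w4] w_supp]] := alternating_dep ht lt.
have [w_sum w_pt] := (affine_depP t w).1 dep.
(* Moving along the affine dependency until the weight of [v2] or [v4] vanishes. *)
have move_along (s : R) (S' : {set V}) : 0 <= s -> (forall i, 0 <= lam i + s * w i) ->
    (forall i, i \notin S' -> lam i + s * w i = 0) ->
    conv t S' (\sum_i lam i *: vertex_pt t i).
  move=> s0 ge0 supp; apply/convP; exists (fun i => lam i + s * w i).
    by split=> //; rewrite big_split /= -mulr_sumr w_sum mulr0 addr0.
  under [RHS]eq_bigr do rewrite scalerDl -scalerA.
  by rewrite big_split /= -scaler_sumr w_pt scaler0 addr0.
(* The weights of [v2] and [v4] vanish at [s2] and [s4]. Stopping at the smaller value keeps all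
   weights nonnegative and drops that vertex. *)
pose s2 := lam v2 / - w v2; pose s4 := lam v4 / - w v4.
have s2_ge0 : 0 <= s2 by rewrite divr_ge0 // oppr_ge0 ltW.
have s4_ge0 : 0 <= s4 by rewrite divr_ge0 // oppr_ge0 ltW.
have s2_eq : lam v2 + s2 * w v2 = 0.
  by rewrite /s2 invrN mulrN mulNr divfK ?subrr // ltr0_neq0.
have s4_eq : lam v4 + s4 * w v4 = 0.
  by rewrite /s4 invrN mulrN mulNr divfK ?subrr // ltr0_neq0.
have ge0 s i : 0 <= s -> s <= s2 -> s <= s4 -> 0 <= lam i + s * w i.
  move=> s0 s_2 s_4; have [wi|wi] := leP 0 (w i).
    by rewrite addr_ge0 // mulr_ge0.
  have : i \in [:: v1; v2; v3; v4; v5].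
    by apply/negPn/negP => /w_supp wi0; rewrite wi0 ltxx in wi.
  rewrite !inE; case/or4P => [|||/orP[]] /eqP ei; subst i.
  - by rewrite ltNge (ltW w1) in wi.
  - by rewrite -s2_eq lerD2l ler_nM2r.
  - by rewrite ltNge (ltW w3) in wi.
  - by rewrite -s4_eq lerD2l ler_nM2r.
  by rewrite ltNge (ltW w5) in wi.
have supp0 s i : i \notin [:: v1; v2; v3; v4; v5] -> lam i + s * w i = 0.
  move=> iv; rewrite w_supp // mulr0 addr0 lam_supp //.
  by move: iv; rewrite !inE -!orbA.
have [s24|s42] := lerP s2 s4.
  exists [set v1; v3; v4; v5]; first by rewrite !inE eqxx orbT.
  apply: (move_along s2) => // [i|i iS]; first exact: ge0.
  have [->//|i2] := eqVneq i v2; apply: supp0.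
  by move: iS; rewrite !inE (negbTE i2) -!orbA.
exists [set v1; v2; v3; v5]; first by rewrite !inE eqxx.
apply: (move_along s4) => // [i|i iS]; first by apply: ge0 => //; apply: ltW.
have [->//|i4] := eqVneq i v4; apply: supp0.
by move: iS; rewrite !inE (negbTE i4) -!orbA.
Qed.

(** A pair in no simplex must cross a triangle of the simplex covering its midpoint; that triangle,
    being a face of [T], is crossed by no edge. *)
Lemma edge_persistent T : noncrossing_cover t T -> persistent (edge T).
Proof.
move=> cT b d bd; rewrite edge_face // => nbd.
have [|U UT [bdU|cr|cr]] := cover_subset (A := [set b; d]) ht cT.
- by apply/set0Pn; exists b; rewrite !inE eqxx.
- by case/negP: nbd; apply: faceI UT bdU.
- case: cr => x [p [y [q [z [lt [+ + +] _]]]]]; rewrite !inE -!val_eqE /=.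
  by move=> *; exfalso; lia.
case: cr => a [p [c [q [e [lt [aU cU eU] [pA qA]]]]]].
have [ep eq] : p = b /\ q = d.
  by move: pA qA; rewrite !inE -!val_eqE /= => ? ?; split; apply: val_inj => /=; lia.
subst p q; exists a, c, e; have ace : face T [set a; c; e].
  by apply: (faceI UT); rewrite !subUset !sub1set aU cU eU.
split; try ord_lia.
  by split; rewrite edge_face; try ord_lia;
    apply: (faceI UT); rewrite subUset !sub1set ?aU ?cU ?eU.
move=> x y axc cye; rewrite edge_face; last by ord_lia.
have [_ nc _] := cT.
by apply: (noncrossing_face nc) ace; ord_lia.
Qed.

(** By [cover_subset], the quadruple equals a simplex of [T], or one of its triangles is crossed by
    an edge of [T], or one of its edges crosses a triangle of [T]. *)
Lemma mem_triangulation T a b c d : noncrossing_cover t T ->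
    [&& a < b, b < c & c < d]%N ->
    [/\ edge T a b, edge T a c & edge T a d] ->
    [/\ edge T b c, edge T b d & edge T c d] ->
    [/\ uncrossed (edge T) a b c, uncrossed (edge T) a b d,
      uncrossed (edge T) a c d & uncrossed (edge T) b c d] ->
  [set a; b; c; d] \in T.
Proof.
move=> cT lt [Fab Fac Fad] [Fbc Fbd Fcd] [uabc uabd uacd ubcd].
have [T4 nc _] := cT.
have [|U UT [SU|cr|cr]] := cover_subset (A := [set a; b; c; d]) ht cT.
- by apply/set0Pn; exists a; rewrite !inE eqxx.
- suff -> : [set a; b; c; d] = U by [].
  by apply/eqP; rewrite eqEcard SU T4 // card_quad.
- case: cr => x [p [y [q [z [lt' [xS yS zS] [pU qU]]]]]].
  have Fpq : edge T p q.
    rewrite edge_face; last by ord_lia.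
    by apply: (faceI UT); rewrite subUset !sub1set pU qU.
  move: xS yS zS; rewrite !inE -!orbA.
  by case/or4P=> /eqP ?; case/or4P=> /eqP ?; case/or4P=> /eqP ?; subst;
    exfalso; solve [ ord_lia | apply: (uabc p q) => //; ord_lia | apply: (uabd p q) => //; ord_lia
    | apply: (uacd p q) => //; ord_lia | apply: (ubcd p q) => //; ord_lia].
case: cr => x [p [y [q [z [lt' [xU yU zU] [pS qS]]]]]].
have Fpq : edge T p q.
  move: pS qS; rewrite !inE -!orbA.
  by case/or4P=> /eqP ?; case/or4P=> /eqP ?; subst => //; exfalso; ord_lia.
exfalso; apply: (noncrossing_face nc lt'); last by rewrite -edge_face //; ord_lia.
by apply: (faceI UT); rewrite !subUset !sub1set xU yU zU.
Qed.

(** A simplex of [T] cannot cross, or be crossed by, one of [T']: the edge involved belongs to both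
    triangulations. So it is contained in a simplex of [T']. *)
Lemma F1_inj T T' : noncrossing_cover t T -> noncrossing_cover t T' ->
  F1 T = F1 T' -> T = T'.
Proof.
move=> cT cT' eF; wlog suff sub : T T' cT cT' eF / T \subset T'.
  by apply/eqP; rewrite eqEsubset !sub.
apply/subsetP => S ST; have [T4 nc _] := cT; have [T'4 nc' _] := cT'.
have edgeE x y : (x < y)%N -> face T [set x; y] = face T' [set x; y].
  by move=> xy; rewrite -!edge_face // /edge eF.
have [|U UT [SU|cr|cr]] := cover_subset (A := S) ht cT'.
- by rewrite -card_gt0 T4.
- suff -> : S = U by [].
  by apply/eqP; rewrite eqEcard SU (T4 S) // (T'4 U).
- case: cr => x [p [y [q [z [lt [xS yS zS] [pU qU]]]]]].
  case: (noncrossing_face nc lt).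
    by apply: (faceI ST); rewrite !subUset !sub1set xS yS zS.
  by rewrite edgeE; [apply: (faceI UT); rewrite subUset !sub1set pU qU | ord_lia].
case: cr => x [p [y [q [z [lt [xU yU zU] [pS qS]]]]]].
case: (noncrossing_face nc' lt).
  by apply: (faceI UT); rewrite !subUset !sub1set xU yU zU.
by rewrite -edgeE; [apply: (faceI ST); rewrite subUset !sub1set pS qS | ord_lia].
Qed.

Lemma upflip_F1 T T' : noncrossing_cover t T -> upflip T T' ->
  noncrossing_cover t T' /\ exists e : {set V}, [/\ e \in Gamma_edges T, F1 T' = F1 T :\ e
    & Gamma_edges T' = Gamma_edges T :\ e].
Proof.
move=> cT [v1 [v2 [v3 [v4 [v5 [lt lowT ->]]]]]].
split; first exact: flip_noncrossing_cover.
have [T4 nc _] := cT; exists [set v2; v4].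
have eF := flip_F1 lt T4 nc lowT; split=> //.
  rewrite inE (flip_diagonal lt lowT) subUset !sub1set !inE.
  by have := ltn_ord v5; ord_lia.
by apply/setP => A; rewrite inE eF !inE -!andbA.
Qed.

(** A missing edge has vertices [a] before it and [e] after it, so every edge at vertex [0] or [n+1]
    belongs to every triangulation. *)
Lemma Gamma_edges_F1 T T' : noncrossing_cover t T -> noncrossing_cover t T' ->
  (Gamma_edges T' \subset Gamma_edges T) = (F1 T' \subset F1 T).
Proof.
move=> cT cT'; apply/idP/idP => /subsetP sub; apply/subsetP => A; last first.
  by rewrite inE => /andP[/sub AF Ain]; rewrite inE AF.
move=> AF; have [Ain|] := boolP (A \subset inner_vertices n).
  have : A \in Gamma_edges T' by rewrite inE AF.
  by move/sub; rewrite inE => /andP[].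
have : #|A| == 2 by move: AF; rewrite inE => /andP[].
case/cards2P => x [y [xy ->]].
wlog {xy} lt_xy : x y / (x < y)%N => [hw|].
  have [||/val_inj exy] := ltngtP x y; first exact: hw.
    by rewrite setUC; apply: hw.
  by rewrite exy eqxx in xy.
move=> nin; apply/negPn/negP => nF.
have [a [c [e [axc cye _ _]]]] := edge_persistent cT lt_xy nF.
case/negP: nin; rewrite subUset !sub1set !inE.
by have := ltn_ord e; ord_lia.
Qed.

(** The uncrossed triangles of a flippable configuration put the lower simplices in [T]. The flip
    removes an edge absent from [T'], so the inclusion persists. *)
Lemma exists_upflip T T' : noncrossing_cover t T -> noncrossing_cover t T' ->
    F1 T' \proper F1 T ->
  exists T1, [/\ upflip T T1, noncrossing_cover t T1 & F1 T' \subset F1 T1].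
Proof.
move=> cT cT' /properP[sub [A AT AT']].
have : #|A| == 2 by move: AT; rewrite inE => /andP[].
case/cards2P => x [y [xy eA]].
have {xy} [b [d [bd {}eA]]] : exists b d, (b < d)%N /\ A = [set b; d].
  have [lt|lt|/val_inj exy] := ltngtP x y; last by rewrite exy eqxx in xy.
    by exists x, y.
  by exists y, x; rewrite setUC.
subst A; have Dbd : [&& b < d, edge T b d & ~~ edge T' b d]%N by apply/and3P.
have subE x0 y0 : (x0 < y0)%N -> edge T' x0 y0 -> edge T x0 y0.
  by move=> _; apply: subsetP.
have [v1 [v2 [v3 [v4 [v5 [fl nF]]]]]] :=
  exists_flippable (edge_persistent cT) (edge_persistent cT') subE Dbd.
case: fl => lt [F12 F13 F14 F15] [F23 F24 F25] [F34 F35 F45].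
case=> -[u124 u125 u145 u245] [u123 u134 u234 u235 u345].
have lowT : Tlow v1 v2 v3 v4 v5 \subset T.
  apply/subsetP => S; rewrite !inE => /orP[/orP[]|] /eqP->;
    by apply: (mem_triangulation cT); ord_lia || split.
have up : upflip T ((T :\: Tlow v1 v2 v3 v4 v5) :|: Tup v1 v2 v3 v4 v5).
  by exists v1, v2, v3, v4, v5.
exists ((T :\: Tlow v1 v2 v3 v4 v5) :|: Tup v1 v2 v3 v4 v5); split=> //.
  exact: flip_noncrossing_cover.
have [T4 nc _] := cT.
by rewrite (flip_F1 lt T4 nc lowT) subsetD1 sub.
Qed.

Lemma le1_F1 T T' : noncrossing_cover t T -> le1 T T' -> F1 T' \subset F1 T.
Proof.
move=> cT le; elim: le cT => {T T'} // T T1 T' up _ IH cT.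
have [cT1 [e [_ eF _]]] := upflip_F1 cT up.
by apply: subset_trans (IH cT1) _; rewrite eF subsetDl.
Qed.

Lemma F1_le1 T T' : noncrossing_cover t T -> noncrossing_cover t T' ->
  F1 T' \subset F1 T -> le1 T T'.
Proof.
move=> + cT'; have [k] := ubnP #|F1 T|; elim: k T => // k IH T; rewrite ltnS => ub cT sub.
have [eF|neF] := eqVneq (F1 T') (F1 T); first by rewrite (F1_inj cT cT'); [left|].
have [|T1 [up cT1 sub1]] := exists_upflip cT cT'; first by rewrite properEneq neF.
apply: (le1_step up); apply: IH => //; apply: leq_trans ub.
have [_ [e [eT -> _]]] := upflip_F1 cT up.
by apply/proper_card/properD1; move: eT; rewrite inE => /andP[].
Qed.

Lemma upflip_Gamma T T' : noncrossing_cover t T -> noncrossing_cover t T' ->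
  upflip T T' <-> exists e : {set V}, e \in Gamma_edges T :\: Gamma_edges T' /\
                    Gamma_edges T = Gamma_edges T' :|: [set e].
Proof.
move=> cT cT'; split=> [up | [e [eD eG]]].
  have [_ [e [eT _ eG]]] := upflip_F1 cT up; exists e.
  by rewrite eG inE eT !in_setD1 eqxx setUC setD1K.
have eT' : e \notin Gamma_edges T' by move: eD; rewrite inE => /andP[].
have sub : F1 T' \subset F1 T by rewrite -Gamma_edges_F1 // eG subsetUl.
(* The flip provided towards [T'] removes one edge outside [Gamma_edges T'], which can only be [e];
   its result then has the edges of [T'] and equals [T']. *)
have [|T1 [up cT1 sub1]] := exists_upflip cT cT'.
  rewrite properEneq sub andbT; apply/eqP => eF; case/negP: eT'.
  by move: eD; rewrite inE => /andP[_]; rewrite inE -eF => eF1; rewrite inE.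
have [_ [e1 [e1T _ eG1]]] := upflip_F1 cT up.
suff -> : T' = T1 by [].
have subG1 : Gamma_edges T' \subset Gamma_edges T1 by rewrite Gamma_edges_F1.
have e1e : e1 = e.
  apply/set1P; have : e1 \notin Gamma_edges T'.
    by apply/negP => /(subsetP subG1); rewrite eG1 !inE eqxx.
  by move: e1T; rewrite eG in_setU => /orP[->|].
have eqG : Gamma_edges T1 = Gamma_edges T'.
  by rewrite eG1 e1e eG setUC setU1K.
apply: (F1_inj cT' cT1); apply/eqP; rewrite eqEsubset.
by rewrite -!Gamma_edges_F1 // eqG subxx.
Qed.

End FlipOrder.

Theorem theorem14 (R : realFieldType) (n : nat) (t : 'I_n.+2 -> R)
  (hn : (2 <= n)%N)
  (ht : forall i j : 'I_n.+2, (i < j)%N -> t i < t j)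
  (T T' : {set {set 'I_n.+2}}) :
  triangulation t T -> triangulation t T' ->
  (upflip T T' <->
     exists e, e \in Gamma_edges T :\: Gamma_edges T' /\
               Gamma_edges T = Gamma_edges T' :|: [set e])
  /\ (le1 T T' <-> Gamma_edges T' \subset Gamma_edges T).
Proof.
move=> /(triangulationP ht) cT /(triangulationP ht) cT'.
split; first exact: (upflip_Gamma ht cT cT').
rewrite (Gamma_edges_F1 ht cT cT').
by split; [apply: (le1_F1 ht cT) | apply: (F1_le1 ht cT cT')].
Qed.
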